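(* There exists a constant $C>0$ such that for every integer $m\ge 5$ there exist a number of voters $n$, a distribution $\mathcal{D}$ supported on $[0,1]$, and a preference profile $\sigma$ on $n$ voters and $m$ alternatives such that every expected-welfare-maximizing rule $f$ for $\mathcal{D}$ satisfies $$\mathbb{E}[\mathrm{dist}(f(\sigma),\sigma)]\le \frac{C}{m}\cdot\max_{j\in A}\mathbb{E}[\mathrm{dist}(j,\sigma)].$$
   Context: There are $n$ voters $N=\{1,\dots,n\}$ and $m$ alternatives $A=\{1,\dots,m\}$. A preference profile $\sigma=(\sigma_1,\dots,\sigma_n)$ consists of a ranking of $A$ for each voter; position $1$ is the top. A (deterministic) voting rule $f$ maps each preference profile to an alternative. Given a distribution $\mathcal{D}$ and a profile $\sigma$, a random utility profile $u$ consistent with $\sigma$ is generated as follows: independently for each voter $i$, draw $m$ i.i.d. samples from $\mathcal{D}$ and assign them, from highest to lowest, to the alternatives in the order of $\sigma_i$. The social welfare of alternative $j$ is $\mathrm{sw}(j,u)=\sum_{i}u_{ij}$; expectations are over this random $u$. The distortion of $j$ at $\sigma$ is $\mathrm{dist}(j,\sigma)=\mathrm{sw}(j,u)/\max_{k\in A}\mathrm{sw}(k,u)$. A rule is an expected-welfare-maximizing rule for $\mathcal{D}$ if for every profile $\sigma$ it selects an alternative maximizing $\mathbb{E}[\mathrm{sw}(j,u)]$ over $j\in A$. *)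

(* Defs.v *)
From HB Require Import structures.
From mathcomp Require Import all_boot all_order all_fingroup all_algebra.
From mathcomp Require Import all_classical all_reals all_analysis.
From mathcomp Require Import Rstruct Rstruct_topology.
Set Implicit Arguments. Unset Strict Implicit. Unset Printing Implicit Defensive.
Import Order.TTheory GRing.Theory Num.Theory.
Import numFieldNormedType.Exports.
Local Open Scope ring_scope.

Section Voting.
Variable R : realType.

(* A preference profile on n voters and m alternatives: voter i's ranking is
   the permutation [sigma i] mapping a position p (0 = top) to the
   alternative ranked at position p. *)
Definition profile (n m : nat) := 'I_n -> {perm 'I_m}.

Definition rule (n m : nat) := profile n m -> 'I_m.

(* Iterated expectation of F applied to k i.i.d. samples from P:
   E[F(X_1,...,X_k)] = \int P(dx_1) ... \int P(dx_k) F [:: x_1; ...; x_k]. *)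
Fixpoint iexp (P : probability R R) (k : nat) (F : seq R -> R) : R :=
  match k with
  | 0 => F [::]
  | k'.+1 => \int[P]_x iexp P k' (fun xs => F (x :: xs))
  end.

(* Given the n*m samples xs (voter i owns the block xs[i*m .. i*m+m-1]),
   the utility of voter i for alternative j: the samples of voter i are
   sorted from highest to lowest and assigned in the order of sigma i. *)
Definition util n m (sigma : profile n m) (xs : seq R) (i : 'I_n) (j : 'I_m) : R :=
  nth 0 (sort (fun a b => b <= a) (take m (drop (i * m) xs))) ((sigma i)^-1%g j).

Definition sw n m (sigma : profile n m) (xs : seq R) (j : 'I_m) : R :=
  \sum_(i < n) util sigma xs i j.

Definition maxsw n m (sigma : profile n m) (xs : seq R) : R :=
  \big[Num.max/0]_(k < m) sw sigma xs k.

(* distortion of j at sigma under the sampled utilities; when every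
   alternative has welfare 0 (0/0) the convention is distortion 1 *)
Definition distortion n m (sigma : profile n m) (xs : seq R) (j : 'I_m) : R :=
  if maxsw sigma xs == 0 then 1 else sw sigma xs j / maxsw sigma xs.

Definition Esw n m (P : probability R R) (sigma : profile n m) (j : 'I_m) : R :=
  iexp P (n * m) (fun xs => sw sigma xs j).

Definition Edist n m (P : probability R R) (sigma : profile n m) (j : 'I_m) : R :=
  iexp P (n * m) (fun xs => distortion sigma xs j).

Definition supported_on01 (P : probability R R) : Prop :=
  P `[0%R, 1%R]%classic = 1%E.

Definition expected_welfare_maximizing n m (P : probability R R) (f : rule n m) : Prop :=
  forall sigma : profile n m, forall j : 'I_m, Esw P sigma j <= Esw P sigma (f sigma).

End Voting.

Definition Rr : realType := Rdefinitions.R.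

(* Main.v *)
Require Import Defs.
From HB Require Import structures.
From mathcomp Require Import all_boot all_order all_fingroup all_algebra.
From mathcomp Require Import all_classical all_reals all_analysis.
From mathcomp Require Import Rstruct Rstruct_topology.
From mathcomp Require Import measurable_realfun lra ring zify.
Import Order.TTheory GRing.Theory Num.Theory.
Local Open Scope ring_scope.
Set Implicit Arguments.
Unset Strict Implicit.

(* Take n = m voters and the law of three values 0, d, 1 with weights 1/2, 1/2 - p,
   p, where p = m^-4 and d = p^2. Alternative a (here [ord_max]) is on top for two
   voters and last for all others; every other alternative is on top for at most
   one voter; alternative b is second for everybody.
   Expected welfare is dominated by the rare value 1: the top sample has mean about
   m p, the others at most d + C(m,2) p^2, which is too small to compensate for one
   top position even when summed over m voters. Hence a is the only welfare maximizer.
   Typically, however, no sample equals 1 and every voter has at least two samples d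
   and one sample 0. Then b has the maximal welfare m d while a has 2 d, so that the
   distortions are 1 and 2 / m. Atypical samples have probability O(1 / m). *)

(** * Integration against a finite mixture of point masses *)

Section Mixture.
Variables (R : realType) (n : nat) (w : nat -> {nonneg R}) (x : nat -> R).
Import HBNNSimple.

Definition mixture : set R -> \bar R :=
  msum (fun i => mscale (w i) \d_(x i)) n.

HB.instance Definition _ := Measure.copy mixture
  (msum (fun i => mscale (w i) \d_(x i)) n).

Lemma mixtureE (A : set R) :
  mixture A = (\sum_(i < n) (w i)%:num * (x i \in A)%:R)%:E.
Proof.
rewrite -sumEFin /mixture /msum; apply: eq_bigr => i _.
by rewrite EFinM /mscale /= -diracE.
Qed.

(* The integral is by definition a supremum over the simple functions below f, reached
   at the largest of the f(x i) times the indicator of x i. This covers the integrands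
   of [iexp] without a proof that they are measurable. *)
Lemma ge0_integral_mixture (f : R -> R) : (forall y, 0 <= f y) ->
  (\int[mixture]_y (f y)%:E = (\sum_(i < n) (w i)%:num * f (x i))%:E)%E.
Proof.
move=> f0.
have sumE (h : {nnsfun R >-> R}) :
    sintegral mixture h = (\sum_(i < n) (w i)%:num * h (x i))%:E.
  rewrite -integralT_nnsfun.
  rewrite /mixture ge0_integral_measure_sum //; first last.
  - by apply/measurable_EFinP.
  - by move=> y _; rewrite lee_fin.
  rewrite -sumEFin; apply: eq_bigr => i _.
  rewrite ge0_integral_mscale //; first last.
  - by move=> y _; rewrite lee_fin.
  - by apply/measurable_EFinP.
  rewrite integral_dirac //; last by apply/measurable_EFinP.
  by rewrite diracT mul1e EFinM.
rewrite ge0_integralTE; last by move=> y; rewrite lee_fin.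
apply/eqP; rewrite eq_le; apply/andP; split.
  apply: ge_ereal_sup => _ [h /= hf] <-; rewrite sumE lee_fin.
  by apply: ler_sum => i _; apply: ler_wpM2l => //; rewrite -lee_fin hf.
pose bump i : {nnsfun R >-> R} :=
  scale_nnsfun (indic_nnsfun R (measurable_set1 (x i))) (f0 (x i)).
(* A maximum, unlike a sum, counts a repeated atom only once, so [h] stays below [f]. *)
pose h := bigmax_nnsfun bump n.
have hE y : h y = \big[Num.max/0]_(i < n) (f (x i) * (y == x i)%:R).
  rewrite /h bigmax_nnsfunE; apply: eq_bigr => i _ /=.
  by rewrite mindicE; congr (_ * (nat_of_bool _)%:R); apply/idP/eqP; rewrite inE.
apply: le_trans (_ : (sintegral mixture h <= _)%E).
  rewrite sumE lee_fin; apply: ler_sum => i _; apply: ler_wpM2l => //.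
  by rewrite hE; apply: le_trans (le_bigmax _ _ i); rewrite eqxx mulr1.
apply: ereal_sup_ubound; exists h => //= y; rewrite lee_fin hE.
apply: bigmax_le => // i _; case: eqP => [->|_]; first by rewrite mulr1.
by rewrite mulr0.
Qed.

(** Positive and negative parts both have finite integral, so their difference reduces to the
    nonnegative case. *)
Lemma Rintegral_mixture (f : R -> R) :
  \int[mixture]_y f y = \sum_(i < n) (w i)%:num * f (x i).
Proof.
pose fp y := Num.max (f y) 0; pose fn y := Num.max (- f y) 0.
have -> : \int[mixture]_y f y = fine (\int[mixture]_y (fp y)%:E -
    \int[mixture]_y (fn y)%:E)%E.
  rewrite /Rintegral integralE; congr (fine (_ - _)%E).
    by apply: eq_integral => y _; rewrite funeposE -EFin_max.
  by apply: eq_integral => y _; rewrite funenegE -EFinN -EFin_max.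
rewrite !ge0_integral_mixture; [|by move=> y; rewrite le_max lexx orbT..].
rewrite /= -sumrB; apply: eq_bigr => i _; rewrite -mulrBr; congr (_ * _).
rewrite /fp /fn; have [f0|/ltW f0] := leP 0 (f (x i)).
  by rewrite max_r ?oppr_le0 // subr0.
by rewrite max_l ?oppr_ge0 // sub0r opprK.
Qed.

End Mixture.

(** * Finite mixtures as probability laws *)

Section MixtureProbability.
Variables (R : realType) (n : nat) (w : nat -> {nonneg R}) (x : nat -> R).
Hypothesis w1 : \sum_(i < n) (w i)%:num = 1.

Lemma mixture_setT : mixture n w x setT = 1%E.
Proof. by rewrite mixtureE; under eq_bigr do rewrite in_setT mulr1; rewrite w1. Qed.

Definition mixture_probability : probability R R :=
  HB.pack (mixture n w x)
    (Measure_isProbability.Build _ _ _ (mixture n w x) mixture_setT).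

Lemma mixture_supported_on01 : (forall i, (i < n)%N -> 0 <= x i <= 1) ->
  supported_on01 mixture_probability.
Proof.
move=> x01; rewrite /supported_on01 /= mixtureE; congr EFin.
rewrite -[RHS]w1; apply: eq_bigr => i _.
by rewrite mem_set ?mulr1 //= in_itv /= x01.
Qed.

End MixtureProbability.

(** * Iterated expectations as finite sums *)

Section IteratedExpectation.
Variables (R : realType) (n : nat) (w : nat -> {nonneg R}) (x : nat -> R).
Hypothesis w1 : \sum_(i < n) (w i)%:num = 1.
Implicit Types (F G : seq R -> R) (xs ys : seq R).

Local Notation P := (mixture_probability x w1).
Local Notation atoms := (mkseq x n).

Lemma iexpS k F : iexp P k.+1 F =
  \sum_(i < n) (w i)%:num * iexp P k (fun xs => F (x i :: xs)).
Proof. exact: Rintegral_mixture. Qed.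

(** Only lists of atoms carry weight; this lets facts special to the sample values pass under the
    expectation. *)
Lemma le_iexp k F G :
  (forall xs, size xs = k -> all [in atoms] xs -> F xs <= G xs) ->
  iexp P k F <= iexp P k G.
Proof.
elim: k F G => [|k IH] F G FG; first exact: FG.
rewrite !iexpS; apply: ler_sum => i _; apply: ler_wpM2l => //.
apply: IH => xs sxs axs; apply: FG => /=; first by rewrite sxs.
by rewrite axs andbT; apply: map_f; rewrite mem_iota /=.
Qed.

Lemma eq_iexp k F G : (forall xs, size xs = k -> F xs = G xs) ->
  iexp P k F = iexp P k G.
Proof.
by move=> FG; apply/le_anti/andP; split; apply: le_iexp => xs sxs _; rewrite FG.
Qed.

Lemma iexp_cst k (c : R) : iexp P k (fun=> c) = c.
Proof.
elim: k => [//|k IH]; rewrite iexpS.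
by under eq_bigr do rewrite IH; rewrite -mulr_suml w1 mul1r.
Qed.

Lemma iexpD k F G : iexp P k (fun xs => F xs + G xs) = iexp P k F + iexp P k G.
Proof.
elim: k F G => [//|k IH] F G; rewrite !iexpS -big_split /=.
by apply: eq_bigr => i _; rewrite IH mulrDr.
Qed.

Lemma iexpZ k (c : R) F : iexp P k (fun xs => c * F xs) = c * iexp P k F.
Proof.
elim: k F => [//|k IH] F; rewrite !iexpS mulr_sumr.
by apply: eq_bigr => i _; rewrite IH mulrCA.
Qed.

Lemma iexpB k F G : iexp P k (fun xs => F xs - G xs) = iexp P k F - iexp P k G.
Proof.
rewrite iexpD; congr (_ + _); rewrite -mulN1r -iexpZ.
by apply: eq_iexp => xs _; rewrite mulN1r.
Qed.

Lemma iexp_sum k (I : finType) (F : I -> seq R -> R) :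
  iexp P k (fun xs => \sum_i F i xs) = \sum_i iexp P k (F i).
Proof.
elim: (index_enum I) => [|i s IH].
  by rewrite big_nil -[RHS](iexp_cst k); apply: eq_iexp => xs _; rewrite big_nil.
rewrite big_cons -IH -iexpD.
by apply: eq_iexp => xs _; rewrite big_cons.
Qed.

Lemma iexp_cat j k F :
  iexp P (j + k) F = iexp P j (fun xs => iexp P k (fun ys => F (xs ++ ys))).
Proof.
elim: j F => [//|j IH] F; rewrite addSn !iexpS.
by apply: eq_bigr => i _; rewrite IH.
Qed.

(** Independence of the blocks: the samples before and after block [i] integrate out, since the
    total mass is 1. *)
Lemma iexp_block k m i F : (i < k)%N ->
  iexp P (k * m) (fun xs => F (take m (drop (i * m) xs))) = iexp P m F.
Proof.
move=> ik.
have -> : (k * m = i * m + (m + (k - i.+1) * m))%N.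
  by rewrite -mulSn -mulnDl; congr (_ * _)%N; lia.
rewrite iexp_cat -[RHS](iexp_cst (i * m)); apply: eq_iexp => xs sxs.
rewrite iexp_cat; apply: eq_iexp => ys sys.
rewrite -[RHS](iexp_cst ((k - i.+1) * m)); apply: eq_iexp => zs _.
by rewrite drop_size_cat // take_size_cat.
Qed.

Lemma iexp_prod k (g : R -> R) :
  iexp P k (fun xs => \prod_(y <- xs) g y) =
  (\sum_(i < n) (w i)%:num * g (x i)) ^+ k.
Proof.
elim: k => [|k IH]; first by rewrite /= big_nil.
rewrite iexpS exprS mulr_suml; apply: eq_bigr => i _.
rewrite -mulrA -IH; congr (_ * _); rewrite -iexpZ.
by apply: eq_iexp => xs _; rewrite big_cons.
Qed.

(** The binomial counts the [r]-subsets of samples satisfying [q], each of which contributes the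
    [r]-th power of the probability of [q]. The induction conditions on the first sample and uses
    Pascal's rule. *)
Lemma iexp_bin_count k r (q : pred R) :
  iexp P k (fun xs => 'C(count q xs, r)%:R) =
  'C(k, r)%:R * (\sum_(i < n | q (x i)) (w i)%:num) ^+ r.
Proof.
set p := \sum_(i < n | _) _.
elim: k r => [|k IH] [|r].
- by rewrite /= mulr1.
- by rewrite /= bin0n mul0r.
- rewrite bin0 expr0 mulr1 -[RHS](iexp_cst k.+1).
  by apply: eq_iexp => xs _; rewrite bin0.
rewrite iexpS.
have step i : iexp P k (fun xs => 'C(count q (x i :: xs), r.+1)%:R) =
    'C(k, r.+1)%:R * p ^+ r.+1 + (q (x i))%:R * ('C(k, r)%:R * p ^+ r).
  rewrite -!IH -iexpZ -iexpD; apply: eq_iexp => xs _ /=.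
  by case: (q _); rewrite ?mul0r ?addr0 // mul1r add1n binS natrD.
under eq_bigr do rewrite step mulrDr mulrA.
rewrite big_split /= -!mulr_suml w1 mul1r.
under eq_bigr do rewrite mulrA.
rewrite -!mulr_suml.
have -> : \sum_(i < n) (w i)%:num * (q (x i))%:R = p.
  rewrite /p [RHS]big_mkcond; apply: eq_bigr => i _.
  by case: (q _); rewrite ?mulr1 ?mulr0.
by rewrite binS natrD mulrDl exprS; ring.
Qed.

End IteratedExpectation.

(** * Order statistics expressed through counts *)

Section OrderStatistics.
Variable R : realType.
Implicit Types (y : seq R) (t d : R).

Local Notation sort_desc := (sort (fun a b : R => b <= a)).
Local Notation ostat y k := (nth 0 (sort_desc y) k).

(** The entries at least [t] form an initial segment. Positivity of [t] puts the default 0 of [nth]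
    below it, so positions past the end fit too. *)
Lemma sorted_nth_ge y t k : 0 < t -> sorted (fun a b : R => b <= a) y ->
  (t <= nth 0 y k) = (k < count (>= t) y)%N.
Proof.
move=> t0; elim: y k => [|a y IH] k /=; first by rewrite nth_nil ltn0 leNgt t0.
move=> pth; have ys := path_sorted pth.
have ge_a : all (fun b => b <= a) y.
  by apply: (order_path_min _ pth) => u v z /= uv vz; exact: le_trans vz uv.
case: (leP t a) => ta; first by case: k => [|k] /=; rewrite ?ta // add1n ltnS IH.
have -> : count (>= t) y = 0%N.
  apply/eqP; rewrite -leqn0 leqNgt -has_count; apply/hasPn => z zy.
  by rewrite -ltNge (le_lt_trans _ ta) // (allP ge_a).
rewrite ltn0; apply/negbTE; rewrite -ltNge; case: k => [//|k] /=.
case: (ltnP k (size y)) => ky; last by rewrite nth_default.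
by rewrite (le_lt_trans _ ta) // (allP ge_a) // mem_nth.
Qed.

Lemma ostat_ge y t k : 0 < t -> (t <= ostat y k) = (k < count (>= t) y)%N.
Proof.
move=> t0; rewrite sorted_nth_ge ?count_sort //.
by apply: sort_sorted => u v; exact: le_total.
Qed.

Lemma ostat_mem y k : ostat y k \in 0 :: y.
Proof.
case: (ltnP k (size (sort_desc y))) => ky; last by rewrite nth_default ?mem_head.
by rewrite in_cons -(mem_sort (fun a b : R => b <= a) y) mem_nth ?orbT.
Qed.

Lemma ostat_ge0 y k : all (>= 0) y -> 0 <= ostat y k.
Proof.
by move=> /allP y0; have := ostat_mem y k; rewrite in_cons => /predU1P[->|/y0].
Qed.

(** * Order statistics of samples with values 0, [d], 1 *)

Section ThreeValues.
Variable d : R.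
Hypotheses (d0 : 0 < d) (d1 : d < 1).

Local Notation atom := [in [:: 0; d; 1]].

Lemma atoms_ge0 y : all atom y -> all (>= 0) y.
Proof.
apply: sub_all => z; rewrite !inE => /or3P[] /eqP -> //; exact: ltW.
Qed.

Lemma ostat_atom y k : all atom y ->
  [\/ ostat y k = 0, ostat y k = d | ostat y k = 1].
Proof.
move=> /allP ya; have := ostat_mem y k; rewrite in_cons => /predU1P[->|/ya].
  by constructor 1.
by rewrite !inE => /or3P[] /eqP ->; [constructor 1|constructor 2|constructor 3].
Qed.

Lemma count_atom_ge1 y : all atom y -> count (>= 1) y = count (pred1 1) y.
Proof.
move=> /allP ya; apply: eq_in_count => z /ya; rewrite !inE => /or3P[] /eqP -> /=.
- by rewrite ler10 eq_sym oner_eq0.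
- by rewrite leNgt d1 lt_eqF.
- by rewrite lexx eqxx.
Qed.

Lemma count_atom_ged y : all atom y -> count (>= d) y = count (predC1 0) y.
Proof.
move=> /allP ya; apply: eq_in_count => z /ya; rewrite !inE => /or3P[] /eqP -> /=.
- by rewrite leNgt d0 eqxx.
- by rewrite lexx gt_eqF.
- by rewrite ltW // oner_neq0.
Qed.

(** Bonferroni: with N ones, N - C(N, 2) is at most the indicator of N >= 1. Binomials of N have
    exact expectations by [iexp_bin_count]. *)
Lemma le_top_ostat y : all atom y ->
  'C(count (pred1 1) y, 1)%:R - 'C(count (pred1 1) y, 2)%:R <= ostat y 0.
Proof.
move=> ya; have := ostat_ge y 0 ltr01; rewrite count_atom_ge1 // bin1.
case: (count _ y) => [|c] top; first by rewrite subrr ostat_ge0 ?atoms_ge0.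
rewrite (le_trans _ (_ : 1 <= _)) ?top // lerBlDr -natr1 addrC lerD2l ler_nat.
by rewrite binS bin1 leq_addl.
Qed.

(** A 1 below the top position requires two samples equal to 1, and then the binomial is at least
    1. *)
Lemma ostatS_le y k : all atom y ->
  ostat y k.+1 <= d + 'C(count (pred1 1) y, 2)%:R.
Proof.
move=> ya; have := ostat_ge y k.+1 ltr01; rewrite count_atom_ge1 //.
case: (ostat_atom k.+1 ya) => -> one.
- by rewrite addr_ge0 // ltW.
- by rewrite lerDl.
- rewrite (le_trans (_ : 1 <= 'C(count (pred1 1) y, 2)%:R)) ?lerDr ?(ltW d0) //.
  rewrite lexx in one; rewrite ler1n bin_gt0; apply: leq_trans (esym one); lia.
Qed.

(* Samples of one voter among 0, d, 1: no 1, at least two d and at least one 0. *)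
Definition typical y :=
  (count (pred1 1%R) y == 0)%N && (1 < count (predC1 0%R) y < size y)%N.

Lemma typical_le y k : all atom y -> typical y -> ostat y k <= d.
Proof.
move=> ya /andP[/eqP one _]; have := ostat_ge y k ltr01.
rewrite count_atom_ge1 // one ltn0.
by case: (ostat_atom k ya) => ->; rewrite ?lexx // => _; exact: ltW.
Qed.

Lemma typical_top y k : all atom y -> typical y -> (k <= 1)%N -> ostat y k = d.
Proof.
move=> ya ty k1; apply/le_anti; rewrite typical_le // ostat_ge // count_atom_ged //.
by case/andP: ty => _ /andP[nz _]; exact: leq_ltn_trans nz.
Qed.

Lemma typical_bottom y k : all atom y -> typical y -> size y = k.+1 -> ostat y k = 0.
Proof.
move=> ya /andP[/eqP one /andP[_ nz]] sy; rewrite sy ltnS in nz.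
have := ostat_ge y k ltr01; have := ostat_ge y k d0.
rewrite count_atom_ge1 // count_atom_ged // one ltn0 ltnNge nz /=.
by case: (ostat_atom k ya) => -> //; rewrite lexx.
Qed.

(* The middle term bounds the indicator of N <= 1 by 2 * 2^-N, where N counts the
   nonzero samples, which makes every term easy to integrate. *)
Lemma atypical_le y :
  (~~ typical y)%:R <= \prod_(z <- y) (z != 0)%:R
    + 2 * \prod_(z <- y) (if z != 0 then 2^-1 else 1)
    + 'C(count (pred1 1) y, 1)%:R :> R.
Proof.
have -> : \prod_(z <- y) (if z != 0 then 2^-1 else 1) =
    2^-1 ^+ count (predC1 0) y :> R.
  elim: y => [|z y IH]; first by rewrite big_nil.
  by rewrite big_cons IH /=; case: (z != 0); rewrite ?mul1r // exprS.
have -> : \prod_(z <- y) (z != 0)%:R = (count (predC1 0) y == size y)%:R :> R.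
  rewrite -all_count; elim: y => [|z y IH]; first by rewrite big_nil.
  by rewrite big_cons IH /=; case: (z != 0); rewrite ?mul1r ?mul0r.
have pow_ge0 c : 0 <= 2 * 2^-1 ^+ c :> R by rewrite mulr_ge0 ?exprn_ge0 ?invr_ge0.
rewrite bin1 /typical; case: (posnP (count (pred1 1) y)) => [->|one] /=; last first.
  by rewrite (le_trans (_ : 1 <= (count (pred1 1) y)%:R)) ?ler1n // lerDr addr_ge0.
rewrite addr0; case: ltnP => [nz|nz] /=; last first.
  rewrite (le_trans (_ : 1 <= 2 * 2^-1 ^+ count (predC1 0) y)) ?lerDr //.
  by case: (count _ y) nz => [|[|//]] _; rewrite ?expr0 ?expr1 ?mulr1 ?mulfV // ler1n.
rewrite ltn_neqAle count_size andbT negbK.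
by rewrite lerDl.
Qed.

End ThreeValues.
End OrderStatistics.

(** * The preference profile *)

Section Profile.
Variable k : nat.
Local Notation m := k.+3.

(** Index 1, serving as a voter, as the alternative b and as the second position. Since m is at
    least 3, it differs from [ord0] and [ord_max]. *)
Definition runner_up : 'I_m := lift ord0 ord0.

(* Voters [runner_up] and [ord_max] put [ord_max] first, voter i puts i first; each
   ranking is an involution, so it also maps an alternative to its position. *)
Definition split_profile : profile m m :=
  fun i => tperm ord0 (if i == runner_up then ord_max else i).

Lemma split_position i j :
  ((split_profile i)^-1)%g j = split_profile i j.
Proof. by rewrite /split_profile tpermV. Qed.

Lemma split_profile_top i : (i == runner_up) || (i == ord_max) ->
  split_profile i ord_max = ord0.
Proof.
by rewrite /split_profile => /orP[] /eqP ->; rewrite ?eqxx ?tpermR.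
Qed.

Lemma split_profile_bottom i : ~~ ((i == runner_up) || (i == ord_max)) ->
  split_profile i ord_max = ord_max.
Proof.
rewrite /split_profile negb_or => /andP[/negbTE -> im].
by rewrite tpermD // eq_sym.
Qed.

Lemma split_profile_runner_up i : split_profile i runner_up = runner_up.
Proof.
by rewrite /split_profile; case: eqVneq => ib; rewrite tpermD // eq_sym.
Qed.

Lemma split_profile_neq0 i j : j != ord_max -> i != j -> split_profile i j != ord0.
Proof.
rewrite /split_profile => jm ij; set t := if _ then _ else _.
have tj : t != j by rewrite /t; case: ifP => // _; rewrite eq_sym.
(* Applying the transposition to both sides turns the claim into [t != j]. *)
by rewrite -(inj_eq (@perm_inj _ (tperm ord0 t))) tpermK tpermL eq_sym.
Qed.

End Profile.
Arguments runner_up : clear implicits.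
Arguments split_profile : clear implicits.

(** * Welfare and distortion for fixed samples *)

Section Welfare.
Variables (R : realType) (k : nat) (d : R).
Hypotheses (d0 : 0 < d) (d1 : d < 1).
Local Notation m := k.+3.
Local Notation sigma := (split_profile k).
Local Notation atom := [in [:: 0; d; 1]].
Local Notation block i xs := (take m (drop (i * m) xs)).
Implicit Types (xs : seq R) (i j : 'I_m).

Lemma size_block n m' (xs : seq R) (i : 'I_n) : size xs = (n * m')%N ->
  size (take m' (drop (i * m') xs)) = m'.
Proof.
move=> sxs; rewrite size_takel // size_drop sxs -mulnBl -[X in (X <= _)%N]mul1n.
by rewrite leq_mul2r subn_gt0 ltn_ord orbT.
Qed.

Lemma all_block n m' (q : pred R) (xs : seq R) (i : 'I_n) : all q xs ->
  all q (take m' (drop (i * m') xs)).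
Proof. by move/allP => qxs; apply/allP => z /mem_take/mem_drop/qxs. Qed.

Lemma utilE xs i j : util sigma xs i j =
  nth 0 (sort (fun a b => b <= a) (block i xs)) (sigma i j).
Proof. by rewrite /util split_position. Qed.

Variable xs : seq R.
Hypotheses (sxs : size xs = (m * m)%N) (axs : all atom xs).

Lemma sw_ge0 j : 0 <= sw sigma xs j.
Proof.
apply: sumr_ge0 => i _; rewrite utilE ostat_ge0 //.
exact/all_block/(atoms_ge0 d0).
Qed.

Lemma sw_le_maxsw j : sw sigma xs j <= maxsw sigma xs.
Proof. exact: le_bigmax. Qed.

Lemma maxsw_ge0 : 0 <= maxsw sigma xs.
Proof. exact: le_trans (sw_ge0 ord0) (sw_le_maxsw _). Qed.

Lemma distortion_ge0 j : 0 <= distortion sigma xs j.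
Proof.
by rewrite /distortion; case: ifP => // _; rewrite divr_ge0 ?sw_ge0 ?maxsw_ge0.
Qed.

Lemma distortion_le1 j : distortion sigma xs j <= 1.
Proof.
rewrite /distortion; case: eqVneq => // max0.
by rewrite ler_pdivrMr ?mul1r ?sw_le_maxsw // lt_neqAle eq_sym max0 maxsw_ge0.
Qed.

Section Typical.
Hypothesis typ : forall i : 'I_m, typical (block i xs).

Lemma typical_sw_le j : sw sigma xs j <= m%:R * d.
Proof.
have -> : m%:R * d = \sum_(i < m) d.
  by rewrite sumr_const card_ord mulr_natl.
by apply: ler_sum => i _; rewrite utilE typical_le // all_block.
Qed.

Lemma typical_sw_runner_up : sw sigma xs (runner_up k) = m%:R * d.
Proof.
rewrite /sw (eq_bigr (fun=> d)) ?sumr_const ?card_ord ?mulr_natl // => i _.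
by rewrite utilE split_profile_runner_up (typical_top d0 d1) // all_block.
Qed.

Lemma typical_maxsw : maxsw sigma xs = m%:R * d.
Proof.
apply/le_anti/andP; split.
  apply: bigmax_le => [|j _]; last exact: typical_sw_le.
  by rewrite mulr_ge0 // ltW.
by rewrite -typical_sw_runner_up sw_le_maxsw.
Qed.

Lemma typical_sw_max : sw sigma xs ord_max = 2 * d.
Proof.
(* Only these two voters give [ord_max] a nonzero utility. *)
rewrite /sw (bigD1 (runner_up k)) //= (bigD1 ord_max) //= big1 ?addr0; last first.
  move=> i /andP[ib im]; rewrite utilE split_profile_bottom ?negb_or ?ib //.
  by rewrite (typical_bottom d0 d1) ?size_block // all_block.
rewrite !utilE !split_profile_top ?eqxx ?orbT //.
by rewrite !(typical_top d0 d1) ?all_block // mulr2n mulrDl mul1r.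
Qed.

Lemma typical_distortion_runner_up : distortion sigma xs (runner_up k) = 1.
Proof.
rewrite /distortion typical_sw_runner_up typical_maxsw.
by case: eqVneq => // ?; rewrite divff.
Qed.

Lemma typical_distortion_max : distortion sigma xs ord_max = 2 / m%:R.
Proof.
have dm : m%:R * d != 0 by rewrite mulf_neq0 ?gt_eqF.
rewrite /distortion typical_sw_max typical_maxsw (negbTE dm).
by rewrite invfM mulrACA divff ?mulr1 // gt_eqF.
Qed.

End Typical.

(** The number of atypical voters. It is at least 1 unless all are typical, so as an error term it
    absorbs any distortion in [0, 1]: a union bound that is linear under expectation. *)
Local Notation atyp := (\sum_(i < m) (~~ typical (block i xs))%:R).

Lemma typicalVatypical : (forall i : 'I_m, typical (block i xs)) \/
  1 <= atyp :> R.
Proof.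
have [[i ti]|all_typ] := pselect (exists i : 'I_m, ~~ typical (block i xs)); last first.
  by left=> i; apply: contrapT => /negP ti; apply: all_typ; exists i.
by right; rewrite (bigD1 i) //= ti lerDl sumr_ge0.
Qed.

Lemma distortion_max_le : distortion sigma xs ord_max <= 2 / m%:R + atyp.
Proof.
have [/typical_distortion_max ->|atyp1] := typicalVatypical.
  by rewrite lerDl sumr_ge0.
by rewrite (le_trans (distortion_le1 _)) // (le_trans atyp1) // lerDr divr_ge0.
Qed.

Lemma distortion_runner_up_ge :
  1 - atyp <= distortion sigma xs (runner_up k).
Proof.
have [/typical_distortion_runner_up ->|atyp1] := typicalVatypical.
  by rewrite gerBl sumr_ge0.
by rewrite (le_trans _ (distortion_ge0 _)) // subr_le0.
Qed.

End Welfare.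

(** * Expected welfare and distortion under the three-point law *)

Section ThreePointLaw.
Variables (R : realType) (p d : R).
Hypotheses (p0 : 0 <= p) (p2 : p <= 2^-1) (d0 : 0 < d) (d1 : d < 1).

Let weight i := nth 0 [:: 2^-1; 2^-1 - p; p] i.

Let weight_ge0 i : 0 <= weight i.
Proof. by case: i => [|[|[|i]]]; rewrite /weight /= ?nth_nil ?subr_ge0 ?invr_ge0. Qed.

Let w i := NngNum (weight_ge0 i).
Let x := nth 0 [:: 0; d; 1].

Let sumw (F : nat -> R) : \sum_(i < 3) (w i)%:num * F i =
  2^-1 * F 0 + (2^-1 - p) * F 1 + p * F 2.
Proof. by rewrite !big_ord_recl big_ord0 /= addr0 addrA. Qed.

Let w1 : \sum_(i < 3) (w i)%:num = 1.
Proof.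
by under eq_bigr do rewrite -[(w _)%:num]mulr1; rewrite (sumw (fun=> 1)); field.
Qed.

Definition three_point : probability R R := mixture_probability x w1.

Lemma three_point_supported_on01 : supported_on01 three_point.
Proof.
apply: mixture_supported_on01 => i _.
by case: i => [|[|[|i]]]; rewrite /x /= ?nth_nil ?lexx ?ler01 ?(ltW d0) ?(ltW d1).
Qed.

Let p_one : \sum_(i < 3 | x i == 1) (w i)%:num = p.
Proof.
rewrite big_mkcond !big_ord_recl big_ord0 /=.
by rewrite [0 == 1]eq_sym oner_eq0 lt_eqF // eqxx !add0r addr0.
Qed.

Lemma iexp_bin_count_ones k r :
  iexp three_point k (fun xs => 'C(count (pred1 1) xs, r)%:R) = 'C(k, r)%:R * p ^+ r.
Proof. by rewrite (iexp_bin_count _ w1) p_one. Qed.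

Lemma iexp_atypical_le k :
  iexp three_point k (fun y => (~~ typical y)%:R) <=
  2^-1 ^+ k + 2 * (3 / 4) ^+ k + k%:R * p.
Proof.
apply: le_trans; first by apply: le_iexp => y _ _; exact: atypical_le.
rewrite !iexpD iexpZ !iexp_prod iexp_bin_count_ones bin1 expr1.
rewrite (sumw (fun i => (x i != 0)%:R)) (sumw (fun i => if x i != 0 then 2^-1 else 1)) /=.
rewrite /x /= eqxx oner_neq0 gt_eqF //=.
(* Factors per sample: a nonzero value has probability 1/2, and halving its weight leaves 1/2 + 1/4
   = 3/4. *)
rewrite (_ : _ + p * 1 = 2^-1); last by field.
by rewrite (_ : _ + p * 2^-1 = 3 / 4); last by field.
Qed.

(** The score of position [j]: expected welfare is the positional scoring rule with these scores. *)
Definition mean_ostat m j :=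
  iexp three_point m (fun y => nth 0 (sort (fun a b => b <= a) y) j).

Lemma mean_ostat_ge0 m j : 0 <= mean_ostat m j.
Proof.
rewrite -[leLHS](iexp_cst x w1 m); apply: le_iexp => y _ ya.
exact/ostat_ge0/(atoms_ge0 d0).
Qed.

Lemma mean_ostat0_ge m : m%:R * p - 'C(m, 2)%:R * p ^+ 2 <= mean_ostat m 0.
Proof.
rewrite -[p in leLHS]expr1 -{1}(bin1 m) -!iexp_bin_count_ones -iexpB.
by apply: le_iexp => y _; exact: le_top_ostat.
Qed.

Lemma mean_ostatS_le m j : mean_ostat m j.+1 <= d + 'C(m, 2)%:R * p ^+ 2.
Proof.
rewrite -iexp_bin_count_ones -[d](iexp_cst x w1 m) -iexpD.
by apply: le_iexp => y _; exact: ostatS_le.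
Qed.

Section Split.
Variable k : nat.
Local Notation m := k.+3.
Local Notation sigma := (split_profile k).

Lemma EswE (j : 'I_m) :
  Esw three_point sigma j = \sum_(i < m) mean_ostat m (sigma i j).
Proof.
rewrite /Esw /sw iexp_sum; apply: eq_bigr => i _.
rewrite /mean_ostat -(iexp_block x w1 m _ (ltn_ord i)).
by apply: eq_iexp => xs _; rewrite utilE.
Qed.

Lemma Esw_max_ge : 2 * mean_ostat m 0 <= Esw three_point sigma ord_max.
Proof.
rewrite EswE (bigD1 (runner_up k)) //= (bigD1 ord_max) //=.
rewrite !split_profile_top ?eqxx ?orbT //= addrA mulr2n mulrDl mul1r lerDl.
by apply: sumr_ge0 => i _; exact: mean_ostat_ge0.
Qed.

Lemma mean_ostat_le (j : nat) : (0 < j)%N ->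
  mean_ostat m j <= d + 'C(m, 2)%:R * p ^+ 2.
Proof. by case: j => // j _; exact: mean_ostatS_le. Qed.

Lemma Esw_le (j : 'I_m) : j != ord_max ->
  Esw three_point sigma j <= mean_ostat m 0 + m%:R * (d + 'C(m, 2)%:R * p ^+ 2).
Proof.
move=> jm; set c := d + _.
have c0 : 0 <= c := le_trans (mean_ostat_ge0 m 1) (mean_ostatS_le m 0).
have le_c i l : split_profile k i l != ord0 -> mean_ostat m (split_profile k i l) <= c.
  by move=> il; apply: mean_ostat_le; rewrite lt0n.
(* Only voter [j] can have [j] on top. That voter is charged the top score plus [c], which covers
   both cases, and every other voter is charged [c]. *)
have -> : m%:R * c = c + \sum_(i < m | i != j) c.
  by rewrite sumr_const cardC1 card_ord -mulrS mulr_natl.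
rewrite EswE (bigD1 j) // addrA.
apply: lerD.
  have [->|/le_c le] := eqVneq (split_profile k j j) ord0.
    by rewrite lerDl.
  by rewrite (le_trans le) // lerDr mean_ostat_ge0.
by apply: ler_sum => i ij; rewrite le_c ?split_profile_neq0.
Qed.

(** Union bound: each of the m voters is atypical with at most the probability in
    [iexp_atypical_le]. *)
Lemma Edist_max_le :
  Edist three_point sigma ord_max <=
  2 / m%:R + m%:R * (2^-1 ^+ m + 2 * (3 / 4) ^+ m + m%:R * p).
Proof.
apply: le_trans; first by apply: le_iexp => xs; exact: distortion_max_le.
rewrite iexpD iexp_cst iexp_sum lerD2l.
rewrite -[X in X%:R * (_ + _)]card_ord mulr_natl -sumr_const.
apply: ler_sum => i _.
rewrite (iexp_block x w1 m (fun y => (~~ typical y)%:R) (ltn_ord i)).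
exact: iexp_atypical_le.
Qed.

Lemma Edist_runner_up_ge :
  1 - m%:R * (2^-1 ^+ m + 2 * (3 / 4) ^+ m + m%:R * p) <=
  Edist three_point sigma (runner_up k).
Proof.
apply: le_trans; last by apply: le_iexp => xs _; exact: distortion_runner_up_ge.
rewrite iexpB iexp_cst iexp_sum lerD2l lerN2.
rewrite -[X in X%:R * (_ + _)]card_ord mulr_natl -sumr_const.
apply: ler_sum => i _.
rewrite (iexp_block x w1 m (fun y => (~~ typical y)%:R) (ltn_ord i)).
exact: iexp_atypical_le.
Qed.

End Split.
End ThreePointLaw.

(** * Numerical estimates and conclusion *)

Lemma sqr_mul_geometric_le (R : realType) m : (7 <= m)%N ->
  m%:R ^+ 2 * (3 / 4) ^+ m <= 7 :> R.
Proof.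
elim: m => // m IH; rewrite leq_eqVlt => /predU1P[<-|]; first by lra.
rewrite ltnS => m7; apply: le_trans (IH m7).
have m7R : 7 <= m%:R :> R by rewrite ler_nat.
have g0 : 0 <= (3 / 4) ^+ m :> R by rewrite exprn_ge0 //; lra.
(* The ratio of consecutive terms, 3/4 (1 + 1/m)^2, is below 1 from m = 7 on. *)
by rewrite [(3 / 4) ^+ m.+1]exprS mulrA ler_wpM2r // -natr1; nra.
Qed.

(** After multiplication by m the three terms are at most 7, 14 and 1. *)
Lemma atypical_bound_le (R : realType) m : (7 <= m)%N ->
  m%:R * (2^-1 ^+ m + 2 * (3 / 4) ^+ m + m%:R * (m%:R ^+ 4)^-1) <= 22 / m%:R :> R.
Proof.
move=> m7; have M7 : 7 <= m%:R :> R by rewrite ler_nat.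
have geo := @sqr_mul_geometric_le R m m7.
have half : 2^-1 ^+ m <= (3 / 4) ^+ m :> R by rewrite lerXn2r ?nnegrE; lra.
move: half geo; set g := (3 / 4) ^+ m; set h := 2^-1 ^+ m.
move: (m%:R) M7 => M M7 half geo.
rewrite ler_pdivlMr; last by lra.
have -> : M * (h + 2 * g + M * (M ^+ 4)^-1) * M = M ^+ 2 * h + 2 * (M ^+ 2 * g) + M^-1.
  by field; lra.
have hg : M ^+ 2 * h <= M ^+ 2 * g by rewrite ler_wpM2l ?sqr_ge0.
have M1 : M^-1 <= 1 by rewrite invf_le1; lra.
lra.
Qed.

Lemma distortion_gap (R : realType) k : (46 <= k)%N ->
  exists (P : probability R R) (sigma : profile k.+3 k.+3),
    supported_on01 P /\
    forall f : rule k.+3 k.+3, expected_welfare_maximizing P f ->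
      Edist P sigma (f sigma) <=
      48 / k.+3%:R * \big[Num.max/0]_(j < k.+3) Edist P sigma j.
Proof.
move=> k46; set m := k.+3.
have m49 : 49 <= m%:R :> R by rewrite ler_nat /m; lia.
have atyp := @atypical_bound_le R m (leq_trans (isT : 7 <= 49)%N (k46 : 49 <= m)%N).
set p := (m%:R ^+ 4)^-1 in atyp.
have p0 : 0 < p by rewrite invr_gt0 exprn_gt0; lra.
have Mp : m%:R ^+ 4 * p = 1 by rewrite mulfV // expf_neq0; lra.
have M_le : m%:R <= m%:R ^+ 4 :> R by rewrite ler_eXnr //; lra.
have p2 : p <= 2^-1 by rewrite lef_pV2 ?posrE ?exprn_gt0 //; lra.
clearbody p.
have d0 : 0 < p ^+ 2 by rewrite exprn_gt0.
have d1 : p ^+ 2 < 1 by rewrite expr_lt1 ?(ltW p0) //; lra.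
exists (three_point (p ^+ 2) (ltW p0) p2), (split_profile k).
split; first exact: three_point_supported_on01.
move=> f fmax; set P := three_point _ _ _ in fmax *; set sigma := split_profile k.
(* Any other choice would force twice the top score [E0] to be at most [E0] plus the small remainder
   of [Esw_le]. *)
have -> : f sigma = ord_max.
  apply/eqP; apply: contraT => jm.
  have := le_trans (Esw_max_ge (ltW p0) p2 d0 k)
    (le_trans (fmax sigma ord_max) (Esw_le (ltW p0) p2 d0 d1 jm)).
  have top_ge := mean_ostat0_ge (ltW p0) p2 d0 d1 m.
  have c2 : 'C(m, 2)%:R <= m%:R ^+ 2 :> R.
    rewrite -natrX ler_nat bin2 -divn2 (leq_trans (leq_div _ _)) //.
    by rewrite leq_mul2l leq_pred orbT.
  rewrite -/m; set c := 'C(m, 2)%:R in c2 *; set E0 := mean_ostat _ _ _ _ _.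
  have mean_gt : m%:R * (p ^+ 2 + c * p ^+ 2) < E0.
    apply: lt_le_trans top_ge.
    rewrite -subr_gt0 (_ : _ - _ = p * (m%:R - p * (c + m%:R + m%:R * c))); last by ring.
    (* Each of the three terms is at most m^4, and p m^4 = 1, so what remains is 3 < m. *)
    rewrite pmulr_rgt0 // subr_gt0 (le_lt_trans (_ : _ <= p * (3 * m%:R ^+ 4))) //.
      rewrite ler_pM2l //; move: c2 m49 M_le; set M := m%:R => c2 m49 M_le.
      have M24 : M ^+ 2 <= M ^+ 4 by rewrite ler_weXn2l //; lra.
      have M34 : M ^+ 3 <= M ^+ 4 by rewrite ler_weXn2l //; lra.
      have cM : M * c <= M ^+ 3 by rewrite exprS ler_pM2l //; lra.
      lra.
    by rewrite mulrCA [p * _]mulrC Mp; lra.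
  by rewrite mulr2n mulrDl mul1r lerD2l leNgt mean_gt.
have max_ge : Edist P sigma (runner_up k) <= \big[Num.max/0]_(j < m) Edist P sigma j.
  exact: le_bigmax.
have run_ge := le_trans (Edist_runner_up_ge (ltW p0) p2 d0 d1 k) max_ge.
have max_le := Edist_max_le (ltW p0) p2 d0 d1 k.
have u0 : 0 < m%:R^-1 :> R by rewrite invr_gt0; lra.
have u49 : m%:R^-1 <= 49^-1 :> R by rewrite lef_pV2 ?posrE; lra.
rewrite -/m in run_ge max_le.
move: atyp u0 u49; set t := m%:R * _ in run_ge max_le *.
set u := m%:R^-1 in max_le *; set X := \big[_/_]_(_ < _) _ in run_ge *.
move=> atyp u0 u49; apply: le_trans max_le _; clearbody t u X.
(* Here t <= 22 u and X >= 1 - 22/49 > 1/2, so 2 u + t <= 24 u <= 48 u X. *)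
nra.
Qed.

Theorem theorem2 :
  exists C : Rr, 0 < C /\
  forall m : nat, (5 <= m)%N ->
  exists (n : nat) (P : probability Rr Rr)
         (sigma : profile n m),
    (0 < n)%N /\ supported_on01 P /\
    forall f : rule n m, expected_welfare_maximizing P f ->
      Edist P sigma (f sigma) <= C / m%:R * \big[Num.max/0]_(j < m) Edist P sigma j.
Proof.
exists 48; split=> // m m5; case: (leqP m 48) => [m48|m49].
  (* For m <= 48 the factor 48 / m is at least 1, so a trivial instance suffices. *)
  pose P : probability Rr Rr := \d_(0 : Rr); pose sigma : profile 1 m := fun=> 1%g.
  exists 1%N, P, sigma; split=> //; split.
    by rewrite /supported_on01 /P /= diracE mem_set //= in_itv /= lexx ler01.
  move=> f _; set M := \big[_/_]_(_ < _) _.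
  have M_ge : Edist P sigma (f sigma) <= M by exact: le_bigmax.
  rewrite (le_trans M_ge) // ler_peMl ?bigmax_ge_id //.
  rewrite ler_pdivlMr ?ltr0n ?mul1r ?ler_nat //.
  exact: leq_trans m5.
have -> : m = (m - 3).+3 by lia.
have [|P [sigma [P01 gap]]] := @distortion_gap Rr (m - 3); first by lia.
by exists (m - 3).+3, P, sigma.
Qed.
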